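(* Let $b\ge 0$. Then $$y_b(x)>\max\left(\sqrt{-x/2}\,\sqrt{\frac{\sqrt{1-2x^3}-1}{\sqrt{1-2x^3}+1}},\ \sqrt{-x/6}\right)$$ for all $x\le 0$ with $x<\sigma(b)$.
   Context: The Painlevé II equation is $y''(x)=x\,y(x)+2y(x)^3$. The Hastings–McLeod solution $y_0$ is the real solution, real analytic on all of $\mathbb R$, with $y_0(x)=\sqrt{-x/2}\,(1+o(1))$ as $x\to-\infty$ and $y_0(x)=\mathrm{Ai}(x)(1+o(1))$ as $x\to+\infty$, where $\mathrm{Ai}$ is the Airy function. For $b\in\mathbb R$, $y_b$ denotes the (real, meromorphic) solution of the Painlevé II equation characterized by $$y_b(x)=y_0(x)+\frac{b}{(-x)^{1/4}}\exp\left(-\frac{2\sqrt2}{3}(-x)^{3/2}\right)(1+o(1)),\qquad x\to-\infty$$ (for $b=0$ it is the Hastings–McLeod solution). It is a known fact that such a solution exists and is unique for each $b\in\mathbb R$. $\sigma(b)$ denotes the first (left-most) pole of $y_b$ on the real line, with $\sigma(b)=+\infty$ if $y_b$ has no real poles (in particular $\sigma(0)=+\infty$). *)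

(* Defs.v *)
From Stdlib Require Import Reals.
From Coquelicot Require Import Coquelicot.

Open Scope R_scope.

(* f = g * (1 + o(1)) along the filter F.  Writing out the factor 1 + o(1)
   (instead of the limit of f / g) makes sense also where g vanishes. *)
Definition asymp (F : (R -> Prop) -> Prop) (f g : R -> R) : Prop :=
  exists eps : R -> R,
    filterlim eps F (locally 0) /\ F (fun x => f x = g x * (1 + eps x)).

(* The integral converges only conditionally; it is the limit of the integrals
   over [0, T] as T -> +oo. *)
Definition Ai (x : R) : R :=
  / PI * RInt_gen (fun t => cos (t ^ 3 / 3 + x * t))
                  (at_point 0) (Rbar_locally p_infty).

Definition real_analytic (f : R -> R) : Prop :=
  forall x0 : R, exists a : nat -> R,
    Rbar_lt 0 (CV_radius a) /\
    locally x0 (fun x => f x = PSeries a (x - x0)).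

Definition hastings_mcleod (y0 : R -> R) : Prop :=
  real_analytic y0 /\
  (forall x : R, is_derive_n y0 2 x (x * y0 x + 2 * y0 x ^ 3)) /\
  asymp (Rbar_locally m_infty) y0 (fun x => sqrt (- x / 2)) /\
  asymp (Rbar_locally p_infty) y0 Ai.

Definition holomorphic_at (f : C -> C) (z0 : C) : Prop :=
  locally z0 (fun z => ex_derive f z).

Definition is_pole (f : C -> C) (z0 : C) : Prop :=
  exists (n : nat) (g : C -> C),
    (0 < n)%nat /\ holomorphic_at g z0 /\ g z0 <> RtoC 0 /\
    locally' z0 (fun z => f z = (g z / (z - z0) ^ n)%C).

(* The value of f at a pole is an arbitrary complex number; no condition below
   depends on it (the asymptotics at -oo exclude real poles near -oo). *)
Definition meromorphic (f : C -> C) : Prop :=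
  forall z : C, holomorphic_at f z \/ is_pole f z.

Definition painleve2_meromorphic (Y : C -> C) : Prop :=
  meromorphic Y /\
  exists dY : C -> C, forall z : C, ~ is_pole Y z ->
    is_derive Y z (dY z) /\
    is_derive dY z (z * Y z + 2 * Y z ^ 3)%C.

Definition real_on_line (Y : C -> C) : Prop :=
  forall x : R, ~ is_pole Y (RtoC x) -> Im (Y (RtoC x)) = 0.

Definition on_line (Y : C -> C) (x : R) : R := Re (Y (RtoC x)).

(* Y is y_b, relative to the Hastings-McLeod solution y0. *)
Definition is_y_b (y0 : R -> R) (b : R) (Y : C -> C) : Prop :=
  painleve2_meromorphic Y /\
  real_on_line Y /\
  asymp (Rbar_locally m_infty)
    (fun x => on_line Y x - y0 x)
    (fun x => b / Rpower (- x) (1 / 4) *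
              exp (- (2 * sqrt 2 / 3) * Rpower (- x) (3 / 2))).

(* sigma is the left-most real pole of Y, or +oo if there is none. *)
Definition is_first_real_pole (Y : C -> C) (sigma : Rbar) : Prop :=
  match sigma with
  | Finite s => is_pole Y (RtoC s) /\
                forall p : R, is_pole Y (RtoC p) -> s <= p
  | p_infty => forall p : R, ~ is_pole Y (RtoC p)
  | m_infty => False
  end.

(* Main.v *)
Require Import Defs.
From Stdlib Require Import Reals Lra Psatz.
From Coquelicot Require Import Coquelicot.

Open Scope R_scope.

(** Write the equation as [y'' = 2 y m] with [m = y^2 + x/2].

    The case [b = 0] carries the work.  The quantity [N = y' - m] satisfies
    [N' = - 2 y N - 1/2], so it can cross zero only downwards.  If it were
    nonnegative somewhere it would blow up to the left, where [y] is large, and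
    [y] would have to become negative there.  Hence [y' < m] everywhere
    ([riccati_inequality]).  If [y <= 0 > y'] at some point, then [y' < 0] ever
    after: at the next zero of [y'] one would have [m > 0 > y], so [y'' < 0],
    whereas [y'] reaches zero from below.  This contradicts [y -> 0] at [+oo],
    which follows from the decay of the Airy function.  Since a zero [c <= 0] of
    [y] would have [y' < c/2 <= 0], the solution is positive on [x <= 0]
    ([hm_positive]).

    On the half-line [x <= 0] a positive solution is compared with a function [v]
    by ratios, since [y''/y = x + 2 y^2] increases with [y] whereas [y''] itself
    does not.  If [y <= v] somewhere, the ratio [v/y] has a maximum, that is, some
    multiple [k v] with [k <= 1] touches [y] from below; this is impossible where
    [v'' > x v + 2 v^3].  The first bound, which equals [x^2 / (1 + s)] with
    [s = sqrt (1 - 2 x^3)], satisfies this inequality for all [x <= 0].  The second,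
    [sqrt (- x / 6)], satisfies it only for [(- x)^3 > 3/8].  A touching point [a]
    closer to the origin has [y'/y = 1/(2a)] and small [y], a descent so steep
    that [y] could not remain positive ([no_steep_descent]).

    For [b > 0] the difference [w = y_b - y_0] is positive near [-oo], tends to
    [0] there, and satisfies [w'' = (x + 2 (y_b^2 + y_b y_0 + y_0^2)) w].  As long
    as [w > 0] the coefficient exceeds [x + 6 y_0^2], which is positive by the
    second bound; so [w] keeps increasing, and [y_b > y_0] up to the first pole.
    For [b = 0] the two solutions agree near [-oo], hence up to the first pole. *)

(** * Calculus on the real line *)

Lemma mean_value (f df : R -> R) (a b : R) :
  a < b -> (forall x, a <= x <= b -> is_derive f x (df x)) ->
  exists c, a < c < b /\ f b - f a = df c * (b - a).
Proof.
intros ab H.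
destruct (MVT_cor2 f df a b ab) as [c [E Hc]].
- intros c Hc; apply is_derive_Reals; auto.
- now exists c.
Qed.

Lemma nonincreasing_of_derive (f df : R -> R) (a b : R) :
  a <= b -> (forall x, a <= x <= b -> is_derive f x (df x)) ->
  (forall x, a <= x <= b -> df x <= 0) -> f b <= f a.
Proof.
intros [ab | ->] H Hs; [|lra].
destruct (mean_value f df a b ab H) as [c [Hc E]].
assert (df c <= 0) by (apply Hs; lra).
nra.
Qed.

Lemma nondecreasing_of_derive (f df : R -> R) (a b : R) :
  a <= b -> (forall x, a <= x <= b -> is_derive f x (df x)) ->
  (forall x, a <= x <= b -> 0 <= df x) -> f a <= f b.
Proof.
intros [ab | ->] H Hs; [|lra].
destruct (mean_value f df a b ab H) as [c [Hc E]].
assert (0 <= df c) by (apply Hs; lra).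
nra.
Qed.

Lemma derivable_continuity_pt (f : R -> R) (x l : R) :
  is_derive f x l -> continuity_pt f x.
Proof.
intros H; apply continuity_pt_filterlim.
apply (ex_derive_continuous f x); now exists l.
Qed.

Lemma negative_derive_local (f : R -> R) (d l : R) :
  is_derive f d l -> l < 0 ->
  exists delta, 0 < delta /\
    (forall x, d - delta < x < d -> f d < f x) /\
    (forall x, d < x < d + delta -> f x < f d).
Proof.
intros H Hl; apply is_derive_Reals in H.
assert (P : 0 < - l / 2) by lra.
destruct (H (- l / 2) P) as [delta Hd].
assert (Q : forall h, h <> 0 -> Rabs h < delta -> (f (d + h) - f d) / h < 0).
{ intros h h0 hd; specialize (Hd h h0 hd); apply Rabs_def2 in Hd; lra. }
exists delta; split; [apply delta | split]; intros x Hx.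
- specialize (Q (x - d)).
  replace (d + (x - d)) with x in Q by ring.
  assert (Q1 : (f x - f d) / (x - d) < 0).
  { apply Q; [lra | rewrite Rabs_left; lra]. }
  destruct (Rlt_le_dec (f d) (f x)) as [|Hle]; [assumption | exfalso].
  replace ((f x - f d) / (x - d)) with ((f d - f x) / (d - x)) in Q1
    by (field; lra).
  assert (0 <= (f d - f x) / (d - x)); [|lra].
  apply Rdiv_le_0_compat; lra.
- specialize (Q (x - d)).
  replace (d + (x - d)) with x in Q by ring.
  assert (Q1 : (f x - f d) / (x - d) < 0).
  { apply Q; [lra | rewrite Rabs_right; lra]. }
  destruct (Rlt_le_dec (f x) (f d)) as [|Hle]; [assumption | exfalso].
  assert (0 <= (f x - f d) / (x - d)); [|lra].
  apply Rdiv_le_0_compat; lra.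
Qed.

(** The zero is the supremum of the points up to which [f] stays negative. *)
Lemma first_zero (f : R -> R) (a b : R) :
  a <= b -> (forall x, a <= x <= b -> continuity_pt f x) ->
  f a < 0 -> 0 <= f b ->
  exists d, a < d <= b /\ f d = 0 /\ forall x, a <= x < d -> f x < 0.
Proof.
intros ab Hc Ha Hb.
pose (S := fun x => a <= x <= b /\ forall z, a <= z <= x -> f z < 0).
assert (Sa : S a).
{ split; [lra|]; intros z Hz; replace z with a by lra; exact Ha. }
destruct (completeness S) as [d [Hub Hlub]].
{ exists b; intros x [Hx _]; lra. }
{ now exists a. }
assert (Had : a <= d) by (apply Hub; exact Sa).
assert (Hdb : d <= b) by (apply Hlub; intros x [Hx _]; lra).
assert (neg : forall x, a <= x < d -> f x < 0).
{ intros x Hx.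
  destruct (Rlt_le_dec (f x) 0) as [|Hp]; [assumption | exfalso].
  assert (d <= x); [|lra].
  apply Hlub; intros z [Hz1 Hz2].
  destruct (Rle_lt_dec z x) as [|xz]; [assumption | exfalso].
  assert (f x < 0) by (apply Hz2; lra); lra. }
assert (nbd : forall e, 0 < e -> exists delta, 0 < delta /\
   forall x, Rabs (x - d) < delta -> Rabs (f x - f d) < e).
{ intros e He; destruct (Hc d (conj Had Hdb) e He) as [delta [Hd1 Hd2]].
  exists delta; split; [exact Hd1|]; intros x Hx.
  destruct (Req_dec x d) as [->|xd].
  - rewrite Rminus_diag, Rabs_R0; exact He.
  - apply Hd2; split; [split; [exact I | congruence] | exact Hx]. }
assert (fd : f d = 0).
{ destruct (Rtotal_order (f d) 0) as [Hn | [H0 | Hp]]; [exfalso | exact H0 | exfalso].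
  - destruct (nbd (- f d)) as [delta [Hd1 Hd2]]; [lra|].
    destruct (Req_dec d b) as [->|db]; [lra|].
    pose (x := Rmin b (d + delta / 2)).
    assert (Hx : d < x <= b /\ x <= d + delta / 2).
    { unfold x; repeat split; [apply Rmin_glb_lt; lra | apply Rmin_l | apply Rmin_r]. }
    assert (x <= d); [|lra].
    apply Hub; split; [lra|]; intros z Hz.
    destruct (Rlt_le_dec z d) as [zd|zd]; [apply neg; lra|].
    assert (Q : Rabs (f z - f d) < - f d).
    { apply Hd2; rewrite Rabs_right; lra. }
    apply Rabs_def2 in Q; lra.
  - destruct (nbd (f d)) as [delta [Hd1 Hd2]]; [lra|].
    destruct (Req_dec a d) as [<-|ad]; [lra|].
    pose (x := Rmax a (d - delta / 2)).
    assert (Hx : a <= x < d /\ d - delta / 2 <= x).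
    { unfold x; repeat split; [apply Rmax_l | apply Rmax_lub_lt; lra | apply Rmax_r]. }
    assert (f x < 0) by (apply neg; lra).
    assert (Q : Rabs (f x - f d) < f d).
    { apply Hd2; rewrite Rabs_left; lra. }
    apply Rabs_def2 in Q; lra. }
exists d; split; [|split; [exact fd | exact neg]].
split; [|exact Hdb].
destruct Had as [|<-]; [assumption | lra].
Qed.

Lemma derive_ge0_at_first_zero (f : R -> R) (a d l : R) :
  a < d -> f d = 0 -> (forall x, a <= x < d -> f x < 0) ->
  is_derive f d l -> 0 <= l.
Proof.
intros ad fd neg H.
destruct (Rle_lt_dec 0 l) as [|Hl]; [assumption | exfalso].
destruct (negative_derive_local f d l H Hl) as [delta [Hd [Hd1 _]]].
pose (x := Rmax a (d - delta / 2)).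
assert (Hx : a <= x < d /\ d - delta / 2 <= x).
{ unfold x; repeat split; [apply Rmax_l | apply Rmax_lub_lt; lra | apply Rmax_r]. }
assert (f x < 0) by (apply neg; lra).
assert (f d < f x) by (apply Hd1; lra).
lra.
Qed.

Lemma second_derivative_test (f df : R -> R) (p q m l : R) :
  p < m < q -> (forall x, p < x < q -> is_derive f x (df x)) ->
  (forall x, p < x < q -> f m <= f x) -> is_derive df m l ->
  df m = 0 /\ 0 <= l.
Proof.
intros Hm Hf Hmin Hdf.
assert (opp : is_derive (fun x => - f x) m (- df m)).
{ apply (is_derive_opp f); apply Hf; exact Hm. }
assert (D0 : df m = 0).
{ destruct (Rtotal_order (df m) 0) as [Hn | [H0 | Hp]]; [exfalso | exact H0 | exfalso].
  - destruct (negative_derive_local f m (df m) (Hf m Hm) Hn) as [delta [Hd [_ Hd2]]].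
    pose (x := Rmin ((m + q) / 2) (m + delta / 2)).
    assert (Hx : m < x < q /\ x < m + delta).
    { unfold x; repeat split.
      - apply Rmin_glb_lt; lra.
      - apply Rle_lt_trans with (1 := Rmin_l _ _); lra.
      - apply Rle_lt_trans with (1 := Rmin_r _ _); lra. }
    assert (f x < f m) by (apply Hd2; lra).
    assert (f m <= f x) by (apply Hmin; lra).
    lra.
  - destruct (negative_derive_local _ m (- df m) opp) as [delta [Hd [Hd1 _]]]; [lra|].
    pose (x := Rmax ((m + p) / 2) (m - delta / 2)).
    assert (Hx : p < x < m /\ m - delta < x).
    { unfold x; repeat split.
      - apply Rlt_le_trans with (2 := Rmax_l _ _); lra.
      - apply Rmax_lub_lt; lra.
      - apply Rlt_le_trans with (2 := Rmax_r _ _); lra. }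
    assert (- f m < - f x) by (apply Hd1; lra).
    assert (f m <= f x) by (apply Hmin; lra).
    lra. }
split; [exact D0|].
destruct (Rle_lt_dec 0 l) as [|Hl]; [assumption | exfalso].
destruct (negative_derive_local df m l Hdf Hl) as [delta [Hd [_ Hd2]]].
pose (x := Rmin ((m + q) / 2) (m + delta / 2)).
assert (Hx : m < x < q /\ x < m + delta).
{ unfold x; repeat split.
  - apply Rmin_glb_lt; lra.
  - apply Rle_lt_trans with (1 := Rmin_l _ _); lra.
  - apply Rle_lt_trans with (1 := Rmin_r _ _); lra. }
destruct (mean_value f df m x) as [c [Hc E]]; [lra | intros z Hz; apply Hf; lra |].
assert (df c < df m) by (apply Hd2; lra).
assert (f m <= f x) by (apply Hmin; lra).
nra.
Qed.

(** * Decay of the Airy function *)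

Definition airy_phase (x t : R) : R := t ^ 3 / 3 + x * t.

Definition airy_partial (x T : R) : R :=
  RInt (fun t => cos (airy_phase x t)) 0 T.

Lemma airy_integrand_continuous (x t : R) :
  continuous (fun t => cos (airy_phase x t)) t.
Proof.
apply (ex_derive_continuous (fun t => cos (airy_phase x t))).
unfold airy_phase; auto_derive; exact I.
Qed.

Lemma airy_partial_is_RInt (x T : R) :
  is_RInt (fun t => cos (airy_phase x t)) 0 T (airy_partial x T).
Proof.
apply (RInt_correct (fun t => cos (airy_phase x t))).
apply ex_RInt_continuous; intros; apply airy_integrand_continuous.
Qed.

Lemma airy_partial_derive (x T : R) :
  is_derive (airy_partial x) T (cos (airy_phase x T)).
Proof.
apply (is_derive_RInt (fun t => cos (airy_phase x t)) (airy_partial x) 0 T).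
- apply filter_forall; intros b; apply airy_partial_is_RInt.
- apply airy_integrand_continuous.
Qed.

(** Integration by parts against the phase: with [phi' = t^2 + x] one has
    [cos phi = (sin phi / phi')' + sin phi * phi'' / phi'^2], and the last term
    is dominated by the derivative of [- 1 / phi']. *)
Definition airy_remainder (x T : R) : R :=
  airy_partial x T - sin (airy_phase x T) / (T ^ 2 + x).

Lemma airy_remainder_increment (x S T : R) : 0 < x -> 0 <= S <= T ->
  Rabs (airy_remainder x T - airy_remainder x S) <= / (S ^ 2 + x) - / (T ^ 2 + x).
Proof.
intros Hx HST.
assert (pos : forall t, 0 < t ^ 2 + x) by (intros t; nra).
pose (h := fun t => sin (airy_phase x t) * (2 * t) / (t ^ 2 + x) ^ 2).
assert (D : forall t, is_derive (airy_remainder x) t (h t)).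
{ intros t; unfold airy_remainder.
  replace (h t) with (cos (airy_phase x t) -
     (cos (airy_phase x t) - h t)) by ring.
  apply (is_derive_minus (airy_partial x)
    (fun T => sin (airy_phase x T) / (T ^ 2 + x))); [apply airy_partial_derive|].
  unfold h, airy_phase; specialize (pos t); auto_derive; [lra|].
  change (t * (t * (t * 1)) * / 3 + x * t) with (t ^ 3 / 3 + x * t).
  field; lra. }
assert (P : forall t, is_derive (fun t => / (t ^ 2 + x)) t (- (2 * t) / (t ^ 2 + x) ^ 2)).
{ intros t; specialize (pos t); auto_derive; [lra|]; field; lra. }
assert (B : forall t, 0 <= t -> Rabs (h t) <= (2 * t) / (t ^ 2 + x) ^ 2).
{ intros t Ht; specialize (pos t).
  assert (0 < (t ^ 2 + x) ^ 2) by nra.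
  unfold h, Rdiv.
  rewrite 2 Rabs_mult, (Rabs_right (2 * t)), (Rabs_right (/ _)) by
    (try (apply Rle_ge, Rlt_le, Rinv_0_lt_compat; assumption); lra).
  assert (Hs : Rabs (sin (airy_phase x t)) <= 1)
    by (apply Rabs_le, SIN_bound).
  apply Rmult_le_compat_r; [apply Rlt_le, Rinv_0_lt_compat; assumption|].
  nra. }
apply Rabs_le; split.
- assert (Q := nondecreasing_of_derive
    (fun t => airy_remainder x t - / (t ^ 2 + x))
    (fun t => h t - (- (2 * t) / (t ^ 2 + x) ^ 2)) S T).
  cut (airy_remainder x S - / (S ^ 2 + x) <= airy_remainder x T - / (T ^ 2 + x)); [lra|].
  apply Q; [lra | intros t _; apply (is_derive_minus (airy_remainder x)); auto |].
  intros t Ht; assert (Bt := B t ltac:(lra)); apply Rabs_le_between in Bt.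
  replace (- (2 * t) / (t ^ 2 + x) ^ 2) with (- ((2 * t) / (t ^ 2 + x) ^ 2))
    by (unfold Rdiv; ring).
  lra.
- assert (Q := nonincreasing_of_derive
    (fun t => airy_remainder x t + / (t ^ 2 + x))
    (fun t => h t + (- (2 * t) / (t ^ 2 + x) ^ 2)) S T).
  cut (airy_remainder x T + / (T ^ 2 + x) <= airy_remainder x S + / (S ^ 2 + x)); [lra|].
  apply Q; [lra | intros t _; apply (is_derive_plus (airy_remainder x)); auto |].
  intros t Ht; assert (Bt := B t ltac:(lra)); apply Rabs_le_between in Bt.
  replace (- (2 * t) / (t ^ 2 + x) ^ 2) with (- ((2 * t) / (t ^ 2 + x) ^ 2))
    by (unfold Rdiv; ring).
  lra.
Qed.

Lemma airy_boundary_term (x T : R) : 0 < x ->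
  Rabs (sin (airy_phase x T) / (T ^ 2 + x)) <= / (T ^ 2 + x).
Proof.
intros Hx.
assert (pos : 0 < T ^ 2 + x) by nra.
unfold Rdiv; rewrite Rabs_mult, (Rabs_right (/ _)) by
  (apply Rle_ge, Rlt_le, Rinv_0_lt_compat; assumption).
assert (Hs : Rabs (sin (airy_phase x T)) <= 1) by (apply Rabs_le, SIN_bound).
assert (0 < / (T ^ 2 + x)) by (apply Rinv_0_lt_compat; assumption).
nra.
Qed.

Lemma airy_partial_bound (x T : R) : 0 < x -> 0 <= T ->
  Rabs (airy_partial x T) <= 2 * / x.
Proof.
intros Hx HT.
assert (B := airy_boundary_term x T Hx).
assert (I := airy_remainder_increment x 0 T Hx ltac:(lra)).
assert (R0 : airy_remainder x 0 = 0).
{ unfold airy_remainder, airy_partial, airy_phase.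
  rewrite RInt_point.
  replace (0 ^ 3 / 3 + x * 0) with 0 by field.
  rewrite sin_0; unfold zero; simpl; unfold Rdiv; ring. }
rewrite R0 in I.
replace (0 ^ 2 + x) with x in I by ring.
replace (airy_partial x T) with
  ((airy_remainder x T - 0) + sin (airy_phase x T) / (T ^ 2 + x))
  by (unfold airy_remainder; ring).
assert (0 < / x) by (apply Rinv_0_lt_compat; assumption).
apply Rle_trans with (1 := Rabs_triang _ _); lra.
Qed.

(** The integral up to infinity converges, although not absolutely: this is the
    Cauchy criterion for it. *)
Lemma airy_partial_cauchy (x S u v : R) : 0 < x -> 0 < S -> S <= u -> S <= v ->
  Rabs (airy_partial x v - airy_partial x u) <= 3 * / S ^ 2.
Proof.
intros Hx HS.
assert (inv : forall t, S <= t -> 0 < / (t ^ 2 + x) <= / S ^ 2).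
{ intros t Ht; split.
  - apply Rinv_0_lt_compat; nra.
  - apply Rinv_le_contravar; nra. }
assert (W : forall u v, S <= u <= v ->
  Rabs (airy_partial x v - airy_partial x u) <= 3 * / S ^ 2).
{ clear u v; intros u v Huv.
  assert (Bu := airy_boundary_term x u Hx).
  assert (Bv := airy_boundary_term x v Hx).
  assert (I := airy_remainder_increment x u v Hx ltac:(lra)).
  assert (iu := inv u ltac:(lra)); assert (iv := inv v ltac:(lra)).
  replace (airy_partial x v - airy_partial x u) with
    ((airy_remainder x v - airy_remainder x u) +
     (sin (airy_phase x v) / (v ^ 2 + x) - sin (airy_phase x u) / (u ^ 2 + x)))
    by (unfold airy_remainder; ring).
  apply Rabs_le_between in Bu; apply Rabs_le_between in Bv; apply Rabs_le_between in I.
  apply Rabs_le; lra. }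
intros Hu Hv; destruct (Rle_lt_dec u v) as [uv|uv].
- apply W; lra.
- rewrite Rabs_minus_sym; apply W; lra.
Qed.

(** A crude rate: what matters is that the Airy function tends to [0] at [+oo]. *)
Lemma Ai_bound (x : R) : 0 < x -> Rabs (Ai x) <= 2 * / x.
Proof.
intros Hx.
assert (C : exists l : R, filterlim (airy_partial x) (Rbar_locally p_infty) (locally l)).
{ apply (filterlim_locally_cauchy (F := Rbar_locally p_infty) (airy_partial x)).
  intros eps.
  pose (S := 1 + 3 / eps).
  assert (He := cond_pos eps).
  assert (H3 : 0 < 3 / eps) by (apply Rdiv_lt_0_compat; lra).
  assert (HS : 3 * / S ^ 2 < eps).
  { apply Rmult_lt_reg_r with (S ^ 2); [unfold S; nra|].
    rewrite Rmult_assoc, Rinv_l by (unfold S; nra).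
    apply Rlt_le_trans with (eps * S); [|unfold S; nra].
    unfold S; replace (eps * (1 + 3 / eps)) with (eps + 3) by (field; lra); lra. }
  exists (fun t => S < t); split; [exists S; auto|].
  intros u v Hu Hv.
  apply Rle_lt_trans with (2 := HS).
  apply (airy_partial_cauchy x S u v); unfold S in *; lra. }
destruct C as [l Hl].
assert (G : is_RInt_gen (fun t => cos (airy_phase x t)) (at_point 0) (Rbar_locally p_infty) l).
{ intros P HP; specialize (Hl P HP).
  apply (Filter_prod _ _ _ (fun a => a = 0) (fun T => P (airy_partial x T))).
  - reflexivity.
  - exact Hl.
  - intros a T -> HT; exists (airy_partial x T); split; [|exact HT].
    apply airy_partial_is_RInt. }
change (Ai x) with (/ PI *
  RInt_gen (fun t => cos (airy_phase x t)) (at_point 0) (Rbar_locally p_infty)).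
rewrite (is_RInt_gen_unique _ _ G).
assert (Bl : Rabs l <= 2 * / x).
{ apply le_epsilon; intros e He.
  destruct (Hl (fun z => Rabs (z - l) < e)) as [M HM].
  { exists (mkposreal e He); intros z Hz; exact Hz. }
  assert (H1 := HM (Rmax 0 M + 1) ltac:(generalize (Rmax_r 0 M); lra)).
  assert (H2 := airy_partial_bound x (Rmax 0 M + 1) Hx ltac:(generalize (Rmax_l 0 M); lra)).
  simpl in H1.
  apply Rabs_def2 in H1; apply Rabs_le_between in H2; apply Rabs_le; lra. }
rewrite Rabs_mult, (Rabs_right (/ PI)) by
  (apply Rle_ge, Rlt_le, Rinv_0_lt_compat, PI_RGT_0).
assert (HPI : / PI <= 1).
{ rewrite <- Rinv_1; apply Rinv_le_contravar; [lra|].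
  generalize PI2_1; lra. }
assert (0 < / PI) by (apply Rinv_0_lt_compat, PI_RGT_0).
assert (0 <= Rabs l) by apply Rabs_pos.
nra.
Qed.

(** * Global real solutions with the Hastings-McLeod behaviour *)

(** The asymptotics at the two ends enter in this form: [y] exceeds every smaller
    multiple of [sqrt (- x / 2)] near [-oo], and it cannot keep below a negative
    level near [+oo]. *)
Record hm_profile (y dy : R -> R) : Prop := {
  hm_derive : forall x, is_derive y x (dy x);
  hm_equation : forall x, is_derive dy x (x * y x + 2 * y x ^ 3);
  hm_left : forall k, k < 1 -> exists A, forall x, x < A -> k * sqrt (- x / 2) < y x;
  hm_right : forall e, 0 < e -> exists B, forall x, B < x -> - e < y x }.

Lemma hm_left_ge_1 (y dy : R -> R) : hm_profile y dy ->
  exists A, A <= -8 /\ forall x, x <= A -> 1 <= y x.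
Proof.
intros H; destruct (hm_left y dy H (1 / 2)) as [A HA]; [lra|].
exists (Rmin (A - 1) (-8)); split; [apply Rmin_r|]; intros x Hx.
assert (x <= A - 1) by (apply Rle_trans with (1 := Hx), Rmin_l).
assert (x <= -8) by (apply Rle_trans with (1 := Hx), Rmin_r).
assert (Hs : 1 / 2 * sqrt (- x / 2) < y x) by (apply HA; lra).
assert (H2s : 2 <= sqrt (- x / 2)).
{ replace 2 with (sqrt (2 ^ 2)) at 1 by (apply sqrt_pow2; lra).
  apply sqrt_le_1_alt; lra. }
lra.
Qed.

(** This quantity vanishes along the solutions of the Riccati equation
    [y' = y^2 + x/2], which linearizes to the Airy equation.  For the solutions of
    Painleve II, where [y'' = 2 y (y^2 + x/2)], it obeys a first order equation
    that is linear in it. *)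
Definition riccati_defect (y dy : R -> R) (x : R) : R := dy x - (y x ^ 2 + x / 2).

Lemma riccati_defect_derive (y dy : R -> R) (x : R) : hm_profile y dy ->
  is_derive (riccati_defect y dy) x (- 2 * y x * riccati_defect y dy x - 1 / 2).
Proof.
intros H.
replace (- 2 * y x * riccati_defect y dy x - 1 / 2) with
  ((x * y x + 2 * y x ^ 3) - (2 * dy x * y x ^ 1 + 1 / 2))
  by (unfold riccati_defect; field).
apply (is_derive_minus dy (fun x => y x ^ 2 + x / 2)); [apply (hm_equation y dy H)|].
apply (is_derive_plus (fun x => y x ^ 2) (fun x => x / 2)).
- replace (2 * dy x * y x ^ 1) with (INR 2 * dy x * y x ^ Nat.pred 2) by (simpl; ring).
  apply (is_derive_pow y 2), (hm_derive y dy H).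
- auto_derive; [exact I | field].
Qed.

(** Wherever the defect vanishes, its derivative is [- 1/2]. *)
Lemma riccati_defect_stays_negative (y dy : R -> R) (a b : R) : hm_profile y dy ->
  a < b -> riccati_defect y dy a <= 0 -> riccati_defect y dy b < 0.
Proof.
intros H ab Ha.
set (N := riccati_defect y dy) in *.
assert (D : forall x, is_derive N x (- 2 * y x * N x - 1 / 2))
  by (intros x; apply riccati_defect_derive, H).
assert (S : exists a', a <= a' < b /\ N a' < 0).
{ destruct Ha as [Ha | Ha]; [exists a; lra|].
  assert (Da := D a); rewrite Ha in Da.
  destruct (negative_derive_local N a _ Da) as [delta [Hd [_ Hd2]]]; [lra|].
  exists (Rmin ((a + b) / 2) (a + delta / 2)).
  assert (Hl := Rmin_l ((a + b) / 2) (a + delta / 2)).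
  assert (Hr := Rmin_r ((a + b) / 2) (a + delta / 2)).
  assert (Hg : a < Rmin ((a + b) / 2) (a + delta / 2)) by (apply Rmin_glb_lt; lra).
  split; [lra|].
  rewrite <- Ha; apply Hd2; lra. }
destruct S as [a' [Ha' Na']].
destruct (Rlt_le_dec (N b) 0) as [|Nb]; [assumption | exfalso].
destruct (first_zero N a' b) as [d [Hd [Nd neg]]]; try lra.
{ intros x _; exact (derivable_continuity_pt N x _ (D x)). }
assert (Dd := D d); rewrite Nd in Dd.
assert (0 <= - 2 * y d * 0 - 1 / 2); [|lra].
apply (derive_ge0_at_first_zero N a' d); auto; lra.
Qed.

(** A nonnegative defect would be positive on the whole left side.  There
    [y >= 1] makes it grow, first linearly and then quadratically, in the distance
    to the left; it then dominates [y^2 + x/2 >= x/2] and forces [y' >= 1] near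
    [-oo], so that [y] would become negative. *)
Lemma riccati_inequality (y dy : R -> R) (x0 : R) : hm_profile y dy ->
  dy x0 < y x0 ^ 2 + x0 / 2.
Proof.
intros H; apply Rminus_lt; fold (riccati_defect y dy x0).
destruct (Rlt_le_dec (riccati_defect y dy x0) 0) as [|Hp]; [assumption | exfalso].
assert (D : forall x, is_derive (riccati_defect y dy) x
    (- 2 * y x * riccati_defect y dy x - 1 / 2))
  by (intros x; apply riccati_defect_derive, H).
assert (pos : forall x, x < x0 -> 0 < riccati_defect y dy x).
{ intros x Hx; destruct (Rlt_le_dec 0 (riccati_defect y dy x)) as [|Hn]; [assumption | exfalso].
  assert (Q := riccati_defect_stays_negative y dy x x0 H Hx Hn); lra. }
assert (Ndef : forall x, riccati_defect y dy x = dy x - (y x ^ 2 + x / 2)) by reflexivity.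
set (N := riccati_defect y dy) in *; clearbody N.
destruct (hm_left_ge_1 y dy H) as [A [A8 HA]].
pose (B := Rmin A (x0 - 1)).
assert (BA : B <= A) by apply Rmin_l.
assert (Bx0 : B <= x0 - 1) by apply Rmin_r.
assert (lin : forall x, x <= B -> (B - x) / 2 <= N x).
{ intros x Hx.
  assert (Q : N B + / 2 * B <= N x + / 2 * x).
  { apply (nonincreasing_of_derive (fun x => N x + / 2 * x)
       (fun x => (- 2 * y x * N x - 1 / 2) + / 2)); [exact Hx | |].
    - intros z _; apply (is_derive_plus N (fun x => / 2 * x)); [apply D|].
      auto_derive; [exact I | ring].
    - intros z Hz; assert (1 <= y z) by (apply HA; lra).
      assert (0 < N z) by (apply pos; lra); nra. }
  assert (0 < N B) by (apply pos; lra); lra. }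
assert (quad : forall x, x <= B -> (B - x) ^ 2 / 2 <= N x).
{ intros x Hx.
  assert (Q : N B - (B - B) ^ 2 / 2 <= N x - (B - x) ^ 2 / 2).
  { apply (nonincreasing_of_derive (fun x => N x - (B - x) ^ 2 / 2)
       (fun x => (- 2 * y x * N x - 1 / 2) - (- (B - x)))); [exact Hx | |].
    - intros z _; apply (is_derive_minus N (fun x => (B - x) ^ 2 / 2)); [apply D|].
      auto_derive; [exact I | field].
    - intros z Hz; assert (1 <= y z) by (apply HA; lra).
      assert (0 < N z) by (apply pos; lra).
      assert (L := lin z ltac:(lra)); nra. }
  assert (0 < N B) by (apply pos; lra).
  replace ((B - B) ^ 2 / 2) with 0 in Q by field; lra. }
(* To the left of [B - (2 - B)] the quadratic bound beats [1 - x/2]. *)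
pose (C := 2 * B - 2).
assert (steep : forall x, x <= C -> 1 <= dy x).
{ intros x Hx; unfold C in Hx.
  assert (L := quad x ltac:(lra)); rewrite Ndef in L.
  assert (0 <= y x ^ 2) by apply pow2_ge_0.
  nra. }
assert (yC : 1 <= y C) by (apply HA; unfold C; lra).
assert (Q : y (C - y C) - (C - y C) <= y C - C).
{ apply (nondecreasing_of_derive (fun x => y x - x) (fun x => dy x - 1)); [lra | |].
  - intros z _; apply (is_derive_minus y (fun x => x)); [apply (hm_derive y dy H)|].
    auto_derive; [exact I | ring].
  - intros z Hz; assert (1 <= dy z) by (apply steep; lra); lra. }
assert (1 <= y (C - y C)) by (apply HA; unfold C in *; lra).
lra.
Qed.

(** Otherwise [y] would stay below some negative level up to [+oo]. *)
Lemma positive_of_decreasing (y dy : R -> R) (a : R) : hm_profile y dy ->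
  (forall x, a <= x -> dy x < 0) -> forall x, a <= x -> 0 < y x.
Proof.
intros H neg x Hx.
destruct (Rlt_le_dec 0 (y x)) as [|Hy]; [assumption | exfalso].
destruct (mean_value y dy x (x + 1)) as [c [Hc E]]; [lra | intros; apply (hm_derive y dy H)|].
assert (dy c < 0) by (apply neg; lra).
assert (y1 : y (x + 1) < 0) by nra.
destruct (hm_right y dy H (- y (x + 1))) as [B HB]; [lra|].
pose (z := Rmax B (x + 1) + 1).
assert (Bz : B < z) by (unfold z; generalize (Rmax_l B (x + 1)); lra).
assert (xz : x + 1 <= z) by (unfold z; generalize (Rmax_r B (x + 1)); lra).
assert (- - y (x + 1) < y z) by (apply HB; exact Bz).
assert (y z <= y (x + 1)); [|lra].
apply (nonincreasing_of_derive y dy); [exact xz | intros; apply (hm_derive y dy H) |].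
intros t Ht; apply Rlt_le, neg; lra.
Qed.

(** After such a point [y'] cannot return to zero: at its first zero the Riccati
    inequality gives [y^2 + x/2 > 0], hence [y'' = 2 y (y^2 + x/2) < 0], although
    [y'] comes from below.  So [y] keeps decreasing. *)
Lemma no_downward_crossing (y dy : R -> R) (c : R) : hm_profile y dy ->
  y c <= 0 -> dy c < 0 -> False.
Proof.
intros H yc dyc.
assert (neg : forall x, c <= x -> dy x < 0).
{ intros x Hx.
  destruct (Rlt_le_dec (dy x) 0) as [|Hp]; [assumption | exfalso].
  destruct (first_zero dy c x) as [d [Hd [dyd negd]]]; try lra.
  { intros z _; exact (derivable_continuity_pt dy z _ (hm_equation y dy H z)). }
  destruct (mean_value y dy c d) as [e [He E]]; [lra | intros; apply (hm_derive y dy H)|].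
  assert (dy e < 0) by (apply negd; lra).
  assert (yd : y d < 0) by nra.
  assert (0 <= d * y d + 2 * y d ^ 3).
  { apply (derive_ge0_at_first_zero dy c d); auto; [lra | apply (hm_equation y dy H)]. }
  assert (R := riccati_inequality y dy d H); rewrite dyd in R; nra. }
assert (0 < y c); [|lra].
apply (positive_of_decreasing y dy c); auto; lra.
Qed.

(** At a zero [c <= 0] the Riccati inequality reads [y' < c/2]: a downward
    crossing. *)
Lemma hm_positive (y dy : R -> R) (x : R) : hm_profile y dy -> x <= 0 -> 0 < y x.
Proof.
intros H Hx.
destruct (Rlt_le_dec 0 (y x)) as [|Hy]; [assumption | exfalso].
destruct (hm_left_ge_1 y dy H) as [A [_ HA]].
pose (z := Rmin A x).
assert (zx : z <= x) by apply Rmin_r.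
assert (1 <= y z) by (apply HA, Rmin_l).
destruct (first_zero (fun x => - y x) z x) as [c [Hc [yc _]]]; try lra.
{ intros t _; apply (derivable_continuity_pt (fun x => - y x) t (- dy t)).
  apply (is_derive_opp y), (hm_derive y dy H). }
apply (no_downward_crossing y dy c H); [lra|].
assert (R := riccati_inequality y dy c H).
replace (y c) with 0 in R by lra; lra.
Qed.

(** A line [r] with [r^2 - r' >= x + 1/4]: its slope is [1 / (2 r(0))], so that the
    linear terms in [x] cancel.  The value [9/10] leaves a constant term just
    above [1/4], and keeps [r] positive to the right of [- 3/4]. *)
Definition descent_rate (x : R) : R := 9 / 10 + 5 / 9 * x.

(** With [q = y' + r y] one has [q' - r q = (x + 2 y^2 + r' - r^2) y], which is
    nonpositive as long as [0 <= y] and [2 y^2 <= 1/4].  So [q exp (- int r)] is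
    nonincreasing, [q] stays below its negative initial value, [y] keeps
    decreasing, and its slope stays away from zero. *)
Lemma no_steep_descent (y dy : R -> R) (a : R) : hm_profile y dy ->
  - 3 / 4 <= a -> 0 < y a -> 2 * y a ^ 2 <= 1 / 4 ->
  dy a + descent_rate a * y a < 0 -> False.
Proof.
intros H Ha ya ya2 Hq.
pose (q := fun x => dy x + descent_rate x * y x).
(* The integrating factor: [E' = - r E]. *)
pose (E := fun x => exp (- (9 / 10 * x + 5 / 18 * x ^ 2))).
assert (Epos : forall x, 0 < E x) by (intros; apply exp_pos).
assert (r0 : forall x, a <= x -> 0 < descent_rate x) by (intros; unfold descent_rate; lra).
assert (DE : forall x, is_derive E x (- descent_rate x * E x)).
{ intros x; unfold E, descent_rate; auto_derive; [exact I|].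
  replace (- (9 / 10 * x + 5 / 18 * (x * (x * 1)))) with
    (- (9 / 10 * x + 5 / 18 * x ^ 2)) by ring.
  field. }
assert (Dq : forall x, is_derive q x
   ((x * y x + 2 * y x ^ 3) + (5 / 9 * y x + descent_rate x * dy x))).
{ intros x; apply (is_derive_plus dy (fun x => descent_rate x * y x));
    [apply (hm_equation y dy H)|].
  apply (is_derive_mult descent_rate y); [| apply (hm_derive y dy H) | exact Rmult_comm].
  unfold descent_rate; auto_derive; [exact I | field]. }
assert (mono : forall b, a <= b -> (forall x, a <= x <= b -> 0 <= y x <= y a) ->
  q b * E b <= q a * E a).
{ intros b ab small.
  apply (nonincreasing_of_derive (fun x => q x * E x) (fun x =>
     ((x * y x + 2 * y x ^ 3) + (5 / 9 * y x + descent_rate x * dy x)) * E x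
       + q x * (- descent_rate x * E x))); [exact ab | |].
  - intros x _; apply (is_derive_mult q E); [apply Dq | apply DE | exact Rmult_comm].
  - intros x Hx; specialize (small x Hx); specialize (Epos x).
    replace (_ + _) with ((x + 2 * y x ^ 2 + 5 / 9 - descent_rate x ^ 2) * (y x * E x))
      by (unfold q; ring).
    assert (2 * y x ^ 2 <= 1 / 4) by nra.
    assert (x + 2 * y x ^ 2 + 5 / 9 - descent_rate x ^ 2 <= 0)
      by (unfold descent_rate; nra).
    assert (0 <= y x * E x) by (apply Rmult_le_pos; lra).
    nra. }
assert (qneg : forall b, a <= b -> (forall x, a <= x <= b -> 0 <= y x <= y a) -> q b < 0).
{ intros b ab small; assert (M := mono b ab small).
  assert (Ea := Epos a); assert (Eb := Epos b).
  assert (q a * E a < 0) by (unfold q; nra); nra. }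
assert (neg : forall x, a <= x -> dy x < 0).
{ intros x Hx.
  assert (dya : dy a < 0) by (specialize (r0 a ltac:(lra)); nra).
  destruct (Rlt_le_dec (dy x) 0) as [|Hp]; [assumption | exfalso].
  destruct (first_zero dy a x) as [d [Hd [dyd negd]]]; try lra.
  { intros z _; exact (derivable_continuity_pt dy z _ (hm_equation y dy H z)). }
  assert (mon : forall s t, a <= s <= t -> t <= d -> y t <= y s).
  { intros s t st td; apply (nonincreasing_of_derive y dy); [lra | |].
    - intros; apply (hm_derive y dy H).
    - intros z Hz; destruct (Req_dec z d) as [->|]; [lra|].
      apply Rlt_le, negd; lra. }
  destruct (Rlt_le_dec (y d) 0) as [yd|yd].
  - assert (0 <= d * y d + 2 * y d ^ 3).
    { apply (derive_ge0_at_first_zero dy a d); auto; [lra | apply (hm_equation y dy H)]. }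
    assert (R := riccati_inequality y dy d H); rewrite dyd in R; nra.
  - assert (Q : q d < 0).
    { apply qneg; [lra|]; intros z Hz; split.
      - apply Rle_trans with (1 := yd), mon; lra.
      - apply mon; lra. }
    unfold q in Q; rewrite dyd in Q; specialize (r0 d ltac:(lra)); nra. }
assert (pos := positive_of_decreasing y dy a H neg).
assert (le : forall x, a <= x -> dy x <= q a).
{ intros x Hx.
  assert (M : q x * E x <= q a * E a).
  { apply mono; [exact Hx|]; intros z Hz; split; [apply Rlt_le, pos; lra|].
    apply (nonincreasing_of_derive y dy); [lra | intros; apply (hm_derive y dy H) |].
    intros t Ht; apply Rlt_le, neg; lra. }
  assert (EE : E x <= E a).
  { apply (nonincreasing_of_derive E (fun x => - descent_rate x * E x)); auto.
    intros z Hz; specialize (r0 z ltac:(lra)); specialize (Epos z); nra. }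
  assert (Ea := Epos a); assert (Ex := Epos x).
  assert (q x <= q a) by (unfold q in Hq; fold (q a) in Hq; nra).
  assert (yx := pos x Hx); specialize (r0 x Hx); unfold q at 1 in H0; nra. }
fold (q a) in Hq.
pose (b := a + y a / (- q a)).
assert (L : 0 < y a / (- q a)) by (apply Rdiv_lt_0_compat; lra).
assert (Q : y b - q a * b <= y a - q a * a).
{ apply (nonincreasing_of_derive (fun x => y x - q a * x) (fun x => dy x - q a));
    [unfold b; lra | |].
  - intros x _; apply (is_derive_minus y (fun x => q a * x)); [apply (hm_derive y dy H)|].
    auto_derive; [exact I | ring].
  - intros x Hx; assert (dy x <= q a) by (apply le; lra); lra. }
assert (yb := pos b ltac:(unfold b; lra)).
assert (q a * b = q a * a - y a) by (unfold b; field; lra).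
lra.
Qed.

(** * Comparison with subsolutions *)

(** The point [m] maximizes [v / y], and [k] is the inverse of the maximum.  Near
    [-oo] the ratio is at most about [1], so a value above [1] confines the
    maximum to a compact interval; if there is no such value, the given point is
    itself a maximum, with [k = 1].  Working with the best multiple avoids any
    rate of convergence in the asymptotics at [-oo]. *)
Lemma best_multiple (y dy v : R -> R) (x0 : R) : hm_profile y dy ->
  (forall x, x <= 0 -> continuity_pt v x) ->
  (forall x, x < 0 -> 0 < v x <= sqrt (- x / 2)) -> v 0 = 0 ->
  x0 <= 0 -> y x0 <= v x0 ->
  exists m k, m < 0 /\ 0 < k <= 1 /\ y m = k * v m /\
    forall x, x <= 0 -> k * v x <= y x.
Proof.
intros H cv hv v0 Hx0 yv.
assert (pos := fun x => hm_positive y dy x H).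
destruct (Classical_Prop.classic (exists x, x <= 0 /\ y x < v x)) as [[x1 [Hx1 lt]] | no].
- clear x0 Hx0 yv; rename x1 into x0, Hx1 into Hx0.
  assert (x0neg : x0 < 0).
  { destruct Hx0 as [| ->]; [assumption|]; specialize (pos 0 ltac:(lra)); lra. }
  pose (k0 := y x0 / v x0).
  assert (v0p := proj1 (hv x0 x0neg)); assert (y0p := pos x0 Hx0).
  assert (Hk0 : 0 < k0 < 1).
  { split; [apply Rdiv_lt_0_compat; lra|].
    unfold k0; apply Rlt_div_l; lra. }
  (* To the left of [A] the ratio [v / y] is below its value [/ k0] at [x0]. *)
  destruct (hm_left y dy H k0 (proj2 Hk0)) as [A HA].
  pose (B := Rmin (A - 1) x0).
  assert (BA : B <= A - 1) by apply Rmin_l.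
  assert (Bx : B <= x0) by apply Rmin_r.
  destruct (continuity_ab_maj (fun x => v x / y x) B 0) as [m [max Hm]]; [lra | |].
  { intros x Hx; apply continuity_pt_div; [apply cv; lra | |].
    - exact (derivable_continuity_pt y x _ (hm_derive y dy H x)).
    - specialize (pos x ltac:(lra)); lra. }
  cbv beta in max.
  assert (M1 := max x0 ltac:(lra)).
  assert (g0 : / k0 = v x0 / y x0) by (unfold k0; field; lra).
  assert (k0i : 1 < / k0) by (rewrite <- Rinv_1; apply Rinv_lt_contravar; lra).
  assert (mneg : m < 0).
  { destruct (Req_dec m 0) as [->|]; [|lra].
    rewrite v0 in M1; unfold Rdiv at 2 in M1; rewrite Rmult_0_l in M1; lra. }
  assert (ym := pos m ltac:(lra)); assert (vm := proj1 (hv m mneg)).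
  assert (gk : v m / y m = / (y m / v m)) by (field; lra).
  assert (kk0 : y m / v m <= k0).
  { rewrite <- (Rinv_inv (y m / v m)), <- (Rinv_inv k0).
    apply Rinv_le_contravar; [lra|]; rewrite <- gk, g0; exact M1. }
  exists m, (y m / v m); repeat split.
  + exact mneg.
  + apply Rdiv_lt_0_compat; lra.
  + lra.
  + field; lra.
  + intros x Hx; destruct (Rle_lt_dec B x) as [Bx'|xB].
    * specialize (max x ltac:(lra)); specialize (pos x Hx).
      assert (E : v x <= v m / y m * y x) by (apply Rle_div_l; lra).
      apply Rle_trans with (y m / v m * (v m / y m * y x)).
      -- apply Rmult_le_compat_l; [apply Rlt_le, Rdiv_lt_0_compat; lra | exact E].
      -- right; field; lra.
    * specialize (HA x ltac:(lra)); assert (L := hv x ltac:(lra)).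
      assert (y m / v m * v x <= k0 * v x) by (apply Rmult_le_compat_r; lra).
      assert (k0 * v x <= k0 * sqrt (- x / 2)) by (apply Rmult_le_compat_l; lra).
      lra.
- assert (ge : forall x, x <= 0 -> v x <= y x).
  { intros x Hx; destruct (Rle_lt_dec (v x) (y x)) as [|Hlt]; [assumption|].
    exfalso; apply no; now exists x. }
  assert (G := ge x0 Hx0).
  exists x0, 1; repeat split; try lra.
  + destruct Hx0 as [| ->]; [assumption|]; specialize (pos 0 ltac:(lra)); lra.
  + intros x Hx; specialize (ge x Hx); lra.
Qed.

(** At the touching point [k v'' <= y''], and [y''/y = m + 2 y^2 <= m + 2 v^2]
    because [k <= 1]. *)
Lemma not_strict_subsolution_at_touching (y dy v dv : R -> R) (ddv m k : R) :
  hm_profile y dy ->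
  (forall x, x < 0 -> is_derive v x (dv x)) -> is_derive dv m ddv ->
  m < 0 -> 0 < k <= 1 -> 0 < v m -> y m = k * v m ->
  (forall x, x <= 0 -> k * v x <= y x) ->
  dy m = k * dv m /\ ddv <= m * v m + 2 * v m ^ 3.
Proof.
intros H Dv DDv Hm Hk vm ym le.
assert (T := second_derivative_test (fun x => y x - k * v x)
  (fun x => dy x - k * dv x) (m - 1) 0 m
  ((m * y m + 2 * y m ^ 3) - k * ddv)).
destruct T as [T1 T2]; [lra | | | |].
- intros x Hx; apply (is_derive_minus y (fun x => k * v x));
    [apply (hm_derive y dy H)|].
  apply (is_derive_scal v); apply Dv; lra.
- intros x Hx; rewrite ym, Rminus_diag.
  specialize (le x ltac:(lra)); lra.
- apply (is_derive_minus dy (fun x => k * dv x)); [apply (hm_equation y dy H)|].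
  apply (is_derive_scal dv); exact DDv.
- split; [lra|].
  rewrite ym in T2.
  assert (k ^ 2 <= 1) by nra.
  assert (0 <= v m ^ 3) by (apply pow_le; lra).
  apply Rmult_le_reg_l with k; [lra|].
  assert (k * (k ^ 2 * v m ^ 3) <= k * (1 * v m ^ 3)).
  { apply Rmult_le_compat_l; [lra|]; apply Rmult_le_compat_r; lra. }
  nra.
Qed.

(** * The two lower bounds *)

Lemma cubic_discriminant_pos (x : R) : x <= 0 -> 1 <= 1 - 2 * x ^ 3.
Proof. intros Hx; assert (0 <= (- x) ^ 3) by (apply pow_le; lra); nra. Qed.

Definition root_s (x : R) : R := sqrt (1 - 2 * x ^ 3).

Lemma root_s_ge_1 (x : R) : x <= 0 -> 1 <= root_s x.
Proof.
intros Hx; rewrite <- sqrt_1; apply sqrt_le_1_alt, cubic_discriminant_pos, Hx.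
Qed.

Lemma root_s_sqr (x : R) : x <= 0 -> root_s x ^ 2 = 1 - 2 * x ^ 3.
Proof.
intros Hx; apply pow2_sqrt; generalize (cubic_discriminant_pos x Hx); lra.
Qed.

Lemma root_s_derive (x : R) : x <= 0 -> is_derive root_s x (- 3 * x ^ 2 / root_s x).
Proof.
intros Hx; assert (S := root_s_ge_1 x Hx); assert (P := cubic_discriminant_pos x Hx).
unfold root_s in *; auto_derive; [lra|].
replace (1 + - (2 * (x * (x * (x * 1))))) with (1 - 2 * x ^ 3) by ring.
field; lra.
Qed.

(** The rationalized form of the first bound, smooth up to [x = 0]. *)
Definition algebraic_bound (x : R) : R := x ^ 2 / (1 + root_s x).

Lemma algebraic_bound_eq (x : R) : x <= 0 ->
  sqrt (- x / 2) *
    sqrt ((sqrt (1 - 2 * x ^ 3) - 1) / (sqrt (1 - 2 * x ^ 3) + 1)) =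
  algebraic_bound x.
Proof.
intros Hx; fold (root_s x); unfold algebraic_bound.
assert (S := root_s_ge_1 x Hx); assert (S2 := root_s_sqr x Hx).
rewrite <- sqrt_mult_alt by lra.
replace (- x / 2 * ((root_s x - 1) / (root_s x + 1))) with
  ((x ^ 2 / (1 + root_s x)) ^ 2).
- apply sqrt_pow2, Rdiv_le_0_compat; [apply pow2_ge_0 | lra].
- assert (X3 : x ^ 3 = (1 - root_s x ^ 2) / 2) by lra.
  replace ((x ^ 2 / (1 + root_s x)) ^ 2) with (x * x ^ 3 / (1 + root_s x) ^ 2)
    by (field; lra).
  rewrite X3; field; lra.
Qed.

Lemma algebraic_bound_le (x : R) : x < 0 ->
  0 < algebraic_bound x <= sqrt (- x / 2).
Proof.
intros Hx; assert (S := root_s_ge_1 x ltac:(lra)); split.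
- apply Rdiv_lt_0_compat; nra.
- rewrite <- algebraic_bound_eq by lra; fold (root_s x).
  rewrite <- (Rmult_1_r (sqrt (- x / 2))) at 2.
  apply Rmult_le_compat_l; [apply sqrt_pos|].
  apply Rle_trans with (sqrt 1); [|rewrite sqrt_1; lra].
  apply sqrt_le_1_alt, Rle_div_l; lra.
Qed.

Definition algebraic_bound' (x : R) : R :=
  2 * x / (1 + root_s x) + 3 * x ^ 4 / (root_s x * (1 + root_s x) ^ 2).

Lemma algebraic_bound_derive (x : R) : x <= 0 ->
  is_derive algebraic_bound x (algebraic_bound' x).
Proof.
intros Hx; assert (S := root_s_ge_1 x Hx); assert (D := root_s_derive x Hx).
unfold algebraic_bound, algebraic_bound'; auto_derive.
- split; [now exists (- 3 * x ^ 2 / root_s x) | split; [lra | exact I]].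
- rewrite (is_derive_unique (fun x : R => root_s x) _ _ D); field; lra.
Qed.

Definition algebraic_bound'' (x : R) : R :=
  2 / (1 + root_s x) + 18 * x ^ 3 / (root_s x * (1 + root_s x) ^ 2)
  + 9 * x ^ 6 * (1 + 3 * root_s x) / (root_s x ^ 3 * (1 + root_s x) ^ 3).

Lemma algebraic_bound_derive2 (x : R) : x <= 0 ->
  is_derive algebraic_bound' x (algebraic_bound'' x).
Proof.
intros Hx; assert (S := root_s_ge_1 x Hx); assert (D := root_s_derive x Hx).
unfold algebraic_bound', algebraic_bound''; auto_derive.
- assert (E : ex_derive root_s x) by now exists (- 3 * x ^ 2 / root_s x).
  repeat split; try exact E; try nra.
- rewrite (is_derive_unique (fun x : R => root_s x) _ _ D); field; lra.
Qed.

(** After the substitution [x^3 = (1 - s^2) / 2] the difference of the two sides is a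
    rational function of [s = root_s x >= 1]. *)
Lemma algebraic_bound_strict_subsolution (x : R) : x <= 0 ->
  x * algebraic_bound x + 2 * algebraic_bound x ^ 3 < algebraic_bound'' x.
Proof.
intros Hx; assert (S := root_s_ge_1 x Hx); assert (S2 := root_s_sqr x Hx).
unfold algebraic_bound, algebraic_bound''; set (s := root_s x) in *; clearbody s.
assert (X3 : x ^ 3 = (1 - s ^ 2) / 2) by lra.
replace (x ^ 6) with ((x ^ 3) ^ 2) by ring.
replace (x * (x ^ 2 / (1 + s)) + 2 * (x ^ 2 / (1 + s)) ^ 3) with
  (x ^ 3 / (1 + s) + 2 * (x ^ 3) ^ 2 / (1 + s) ^ 3) by (field; lra).
rewrite X3; apply Rlt_0_minus.
replace (_ - _) with ((4 * s ^ 4 - 5 * s ^ 3 - 9 * s ^ 2 + 9 * s + 9) / (4 * s ^ 3 * (1 + s)))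
  by (field; lra).
apply Rdiv_lt_0_compat.
- (* In powers of [s - 1] the only negative term is linear, and it is absorbed by
     [u^3 - 3 u + 2 = (u - 1)^2 (u + 2) >= 0] for [u = s - 1]. *)
  replace (4 * s ^ 4 - 5 * s ^ 3 - 9 * s ^ 2 + 9 * s + 9) with
    (4 * (s - 1) ^ 4 + 11 * (s - 1) ^ 3 - 8 * (s - 1) + 8) by ring.
  assert (0 <= (s - 1) ^ 4) by (apply pow_le; lra).
  assert (0 <= (s - 1) ^ 3) by (apply pow_le; lra).
  assert (0 <= ((s - 1) - 1) ^ 2 * ((s - 1) + 2))
    by (apply Rmult_le_pos; [apply pow2_ge_0 | lra]).
  lra.
- assert (0 < s ^ 3) by (apply pow_lt; lra); nra.
Qed.

Lemma hm_gt_algebraic_bound (y dy : R -> R) (x : R) : hm_profile y dy -> x <= 0 ->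
  algebraic_bound x < y x.
Proof.
intros H Hx; apply Rnot_le_lt; intros le.
destruct (best_multiple y dy algebraic_bound x) as [m [k [Hm [Hk [ym touch]]]]]; auto.
- intros z Hz; exact (derivable_continuity_pt _ z _ (algebraic_bound_derive z Hz)).
- exact algebraic_bound_le.
- unfold algebraic_bound, Rdiv; ring.
- destruct (not_strict_subsolution_at_touching y dy algebraic_bound algebraic_bound'
    (algebraic_bound'' m) m k) as [_ C]; auto.
  + intros z Hz; apply algebraic_bound_derive; lra.
  + apply algebraic_bound_derive2; lra.
  + apply algebraic_bound_le, Hm.
  + assert (S := algebraic_bound_strict_subsolution m ltac:(lra)); lra.
Qed.

Lemma sqrt_bound_derive (x : R) : x < 0 ->
  is_derive (fun x => sqrt (- x / 6)) x (- / (12 * sqrt (- x / 6))).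
Proof.
intros Hx; assert (P : 0 < sqrt (- x / 6)) by (apply sqrt_lt_R0; lra).
auto_derive; [lra|].
change (- x * / 6) with (- x / 6); field; lra.
Qed.

Lemma sqrt_bound_derive2 (x : R) : x < 0 ->
  is_derive (fun x => - / (12 * sqrt (- x / 6))) x (- / (144 * sqrt (- x / 6) ^ 3)).
Proof.
intros Hx; assert (P : 0 < sqrt (- x / 6)) by (apply sqrt_lt_R0; lra).
auto_derive; [change (- x * / 6) with (- x / 6); repeat split; lra|].
change (- x * / 6) with (- x / 6); field; lra.
Qed.

(** The bound [v] is a strict subsolution where [(- x)^3 > 3/8], in particular to the
    left of [- 3/4].  A touching point [m] to the right of it inherits the logarithmic
    derivative [1 / (2 m)] of the bound, which is below [- r(m)] for the rate [r] of
    [no_steep_descent], and there [2 y^2 <= 2 v^2 = - m / 3 <= 1/4]. *)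
Lemma hm_gt_sqrt_bound (y dy : R -> R) (x : R) : hm_profile y dy -> x <= 0 ->
  sqrt (- x / 6) < y x.
Proof.
intros H Hx; apply Rnot_le_lt; intros le.
destruct (best_multiple y dy (fun x => sqrt (- x / 6)) x) as [m [k [Hm [Hk [ym touch]]]]]; auto.
- intros z Hz; apply (continuity_pt_comp (fun z => - z / 6) sqrt).
  + apply (derivable_continuity_pt _ z (- 1 / 6)); auto_derive; [exact I | field].
  + apply continuity_pt_sqrt; lra.
- intros z Hz; split; [apply sqrt_lt_R0; lra | apply sqrt_le_1_alt; lra].
- replace (- 0 / 6) with 0 by field; apply sqrt_0.
- cbv beta in ym.
  assert (P : 0 < sqrt (- m / 6)) by (apply sqrt_lt_R0; lra).
  assert (P2 : sqrt (- m / 6) ^ 2 = - m / 6) by (apply pow2_sqrt; lra).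
  destruct (not_strict_subsolution_at_touching y dy (fun x => sqrt (- x / 6))
    (fun x => - / (12 * sqrt (- x / 6))) (- / (144 * sqrt (- m / 6) ^ 3)) m k)
    as [dym C]; auto.
  + intros z Hz; apply sqrt_bound_derive; lra.
  + apply sqrt_bound_derive2; lra.
  + cbv beta in dym, C.
    set (v := sqrt (- m / 6)) in *; clearbody v.
    assert (Em : m = - 6 * v ^ 2) by lra.
    assert (m34 : - 3 / 4 <= m).
    { apply Rnot_lt_le; intros far.
      assert (v2 : 1 / 8 < v ^ 2) by lra.
      assert (Hv : 0 < 144 * v ^ 3) by nra.
      apply Rmult_le_compat_r with (r := 144 * v ^ 3) in C; [|lra].
      replace (- / (144 * v ^ 3) * (144 * v ^ 3)) with (- 1) in C by (field; lra).
      replace ((m * v + 2 * v ^ 3) * (144 * v ^ 3)) with (- 576 * (v ^ 2) ^ 3) in C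
        by (rewrite Em; ring).
      assert ((1 / 8) ^ 3 < (v ^ 2) ^ 3); [|lra].
      set (t := v ^ 2) in *; clearbody t; assert (1 / 64 < t ^ 2) by nra; nra. }
    apply (no_steep_descent y dy m H m34).
    * rewrite ym; nra.
    * rewrite ym; assert (k ^ 2 <= 1) by nra; nra.
    * rewrite ym, dym; unfold descent_rate.
      replace (k * - / (12 * v) + (9 / 10 + 5 / 9 * m) * (k * v)) with
        (- (k / (12 * v)) * (1 - 12 * v ^ 2 * (9 / 10 + 5 / 9 * m))) by (field; lra).
      assert (0 < k / (12 * v)) by (apply Rdiv_lt_0_compat; lra).
      assert (0 < 1 - 12 * v ^ 2 * (9 / 10 + 5 / 9 * m)); [rewrite Em; nra|nra].
Qed.

(** * From the asymptotic formulas to inequalities *)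

Lemma asymp_eventually (F : (R -> Prop) -> Prop) {FF : Filter F} (f g : R -> R) (e : R) :
  0 < e -> asymp F f g ->
  F (fun x => exists d, - e < d < e /\ f x = g x * (1 + d)).
Proof.
intros He [eps [L E]].
assert (L' := L (fun d => - e < d < e)).
assert (N : locally 0 (fun d => - e < d < e)).
{ exists (mkposreal e He); intros d Hd; apply Rabs_def2 in Hd.
  unfold minus, plus, opp in Hd; simpl in Hd; lra. }
assert (L2 : F (fun x => - e < eps x < e)) by exact (L' N).
refine (filter_imp _ _ _ (filter_and _ _ L2 E)).
intros x [Hx Ex]; exists (eps x); split; assumption.
Qed.

Lemma hastings_mcleod_profile (y : R -> R) : hastings_mcleod y -> hm_profile y (Derive y).
Proof.
intros [an [eqn [left right]]]; split.
- intros x; apply Derive_correct.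
  destruct (an x) as [a [Ha E]].
  apply (ex_derive_ext_loc (fun t => PSeries a (t - x))).
  + revert E; apply filter_imp; intros t ->; reflexivity.
  + apply (ex_derive_comp (PSeries a) (fun t => t - x)).
    * apply ex_derive_PSeries; rewrite Rminus_diag, Rabs_R0; exact Ha.
    * auto_derive; exact I.
- exact eqn.
- intros k Hk.
  destruct (asymp_eventually (Rbar_locally m_infty) y _ (1 - k) ltac:(lra) left) as [M HM].
  exists (Rmin M 0); intros x Hx.
  assert (xM : x < M) by (apply Rlt_le_trans with (1 := Hx), Rmin_l).
  assert (x0 : x < 0) by (apply Rlt_le_trans with (1 := Hx), Rmin_r).
  destruct (HM x xM) as [d [Hd ->]].
  assert (0 < sqrt (- x / 2)) by (apply sqrt_lt_R0; lra).
  nra.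
- intros e He.
  destruct (asymp_eventually (Rbar_locally p_infty) y _ 1 ltac:(lra) right) as [M HM].
  exists (Rmax M (4 / e)); intros x Hx.
  assert (xM : M < x) by (apply Rle_lt_trans with (2 := Hx), Rmax_l).
  assert (xe : 4 / e < x) by (apply Rle_lt_trans with (2 := Hx), Rmax_r).
  assert (e4 : 0 < 4 / e) by (apply Rdiv_lt_0_compat; lra).
  destruct (HM x xM) as [d [Hd ->]].
  assert (x0 : 0 < x) by lra.
  assert (B := Ai_bound x x0); apply Rabs_le_between in B.
  assert (Hi : 4 * / x < e).
  { apply Rlt_div_l in xe; [|lra]; apply Rlt_div_l; lra. }
  nra.
Qed.

(** * Ordering of solutions *)

Lemma difference_derive (y dy u du : R -> R) (x : R) :
  is_derive y x (dy x) -> is_derive u x (du x) ->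
  is_derive (fun x => u x - y x) x (du x - dy x).
Proof. intros Hy Hu; exact (is_derive_minus u y x _ _ Hu Hy). Qed.

(** The difference of two solutions solves a linear equation with this coefficient. *)
Definition difference_coef (y u : R -> R) (x : R) : R :=
  x + 2 * (u x ^ 2 + u x * y x + y x ^ 2).

Lemma difference_derive2 (y dy u du : R -> R) (x : R) :
  is_derive dy x (x * y x + 2 * y x ^ 3) -> is_derive du x (x * u x + 2 * u x ^ 3) ->
  is_derive (fun x => du x - dy x) x (difference_coef y u x * (u x - y x)).
Proof.
intros Hy Hu; unfold difference_coef.
replace (_ * _) with ((x * u x + 2 * u x ^ 3) - (x * y x + 2 * y x ^ 3)) by ring.
exact (is_derive_minus du dy x _ _ Hu Hy).
Qed.

Definition solves_PII_upto (x1 : R) (u du : R -> R) : Prop :=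
  forall x, x <= x1 -> is_derive u x (du x) /\ is_derive du x (x * u x + 2 * u x ^ 3).

(** Gronwall: the energy [w^2 + w'^2] of the difference, which vanishes near [-oo],
    grows at most exponentially. *)
Lemma solution_unique_forward (y dy u du : R -> R) (x1 A : R) :
  solves_PII_upto x1 y dy -> solves_PII_upto x1 u du ->
  (forall x, x < A -> u x = y x) -> u x1 = y x1.
Proof.
intros Sy Su agree.
destruct (Rlt_le_dec x1 A) as [|Ax]; [now apply agree|].
pose (B := A - 1).
pose (w := fun x => u x - y x); pose (dw := fun x => du x - dy x).
assert (Dw : forall x, x <= x1 -> is_derive w x (dw x)).
{ intros x Hx; apply difference_derive; [apply Sy | apply Su]; exact Hx. }
assert (Ddw : forall x, x <= x1 -> is_derive dw x (difference_coef y u x * w x)).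
{ intros x Hx; apply difference_derive2; [apply Sy | apply Su]; exact Hx. }
destruct (continuity_ab_maj (fun x => difference_coef y u x ^ 2) B x1) as [m [max Hm]].
{ unfold B; lra. }
{ intros x Hx; apply continuity_pt_filterlim.
  apply (ex_derive_continuous (fun x => difference_coef y u x ^ 2)).
  unfold difference_coef; auto_derive; repeat split;
    solve [exists (du x); apply Su; lra | exists (dy x); apply Sy; lra]. }
cbv beta in max; set (M := difference_coef y u m ^ 2) in *.
(* [E' <= 0] needs [|1 + c| <= K] for the coefficient [c], and [|c| <= 1 + c^2]. *)
pose (K := 2 + M).
pose (E := fun x => (w x ^ 2 + dw x ^ 2) * exp (- K * x)).
assert (wB : w B = 0) by (unfold w; rewrite agree; [ring | unfold B; lra]).
assert (dwB : dw B = 0).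
{ assert (D0 : is_derive w B 0).
  { apply (is_derive_ext_loc (fun _ => 0)); [|apply (is_derive_const 0)].
    exists (mkposreal 1 Rlt_0_1); intros t Ht.
    apply Rabs_def2 in Ht; unfold minus, plus, opp in Ht; simpl in Ht.
    unfold w; rewrite agree; [symmetry; apply Rminus_diag | unfold B in Ht; lra]. }
  rewrite <- (is_derive_unique _ _ _ D0); symmetry; apply is_derive_unique.
  apply Dw; unfold B; lra. }
assert (Q : E x1 <= E B).
{ apply (nonincreasing_of_derive E (fun x =>
    (2 * w x * dw x + 2 * dw x * (difference_coef y u x * w x)) * exp (- K * x)
    + (w x ^ 2 + dw x ^ 2) * (- K * exp (- K * x)))); [unfold B; lra | |].
  - intros x Hx; unfold E.
    assert (D1 := Dw x ltac:(lra)); assert (D2 := Ddw x ltac:(lra)).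
    auto_derive.
    + repeat split; eexists; eassumption.
    + rewrite (is_derive_unique (fun x : R => w x) _ _ D1).
      rewrite (is_derive_unique (fun x : R => dw x) _ _ D2); ring.
  - intros x Hx; assert (Mx := max x Hx); unfold K.
    set (c := difference_coef y u x) in *.
    assert (0 < exp (- (2 + M) * x)) by apply exp_pos.
    assert (2 * w x * dw x + 2 * dw x * (c * w x) <= (2 + M) * (w x ^ 2 + dw x ^ 2)).
    { assert (C1 : - (2 + M) <= 1 + c <= 2 + M) by nra.
      assert (P1 : 0 <= (w x + dw x) ^ 2) by apply pow2_ge_0.
      assert (P2 : 0 <= (w x - dw x) ^ 2) by apply pow2_ge_0.
      nra. }
    nra. }
unfold E in Q; rewrite wB, dwB in Q.
assert (0 < exp (- K * x1)) by apply exp_pos.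
assert (0 <= w x1 ^ 2) by apply pow2_ge_0.
assert (0 <= dw x1 ^ 2) by apply pow2_ge_0.
assert (w x1 ^ 2 = 0) by nra.
assert (w x1 = 0) by nra.
unfold w in *; lra.
Qed.

(** The difference [w] is positive and tends to [0] at [-oo], hence it increases at
    some point [c].  To the right of it [w] is convex as long as it is positive,
    since its coefficient exceeds [x + 6 y^2 > 0]; so its slope stays positive. *)
Lemma solution_stays_above (y dy u du : R -> R) (x1 A : R) :
  hm_profile y dy -> x1 <= 0 -> solves_PII_upto x1 u du ->
  (forall x, x < A -> y x < u x) ->
  (forall e, 0 < e -> exists A', forall x, x < A' -> u x - y x < e) ->
  y x1 < u x1.
Proof.
intros H Hx1 Su above decay.
pose (w := fun x => u x - y x); pose (dw := fun x => du x - dy x).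
assert (Dw : forall x, x <= x1 -> is_derive w x (dw x)).
{ intros x Hx; apply difference_derive; [apply (hm_derive y dy H) | apply Su, Hx]. }
assert (Ddw : forall x, x <= x1 -> is_derive dw x (difference_coef y u x * w x)).
{ intros x Hx; apply difference_derive2; [apply (hm_equation y dy H) | apply Su, Hx]. }
pose (B := Rmin A x1 - 1).
assert (BA : B < A) by (unfold B; generalize (Rmin_l A x1); lra).
assert (Bx : B < x1) by (unfold B; generalize (Rmin_r A x1); lra).
assert (wB : 0 < w B) by (unfold w; specialize (above B BA); lra).
destruct (decay (w B) wB) as [A' HA'].
pose (z := Rmin A' B - 1).
assert (zA : z < A') by (unfold z; generalize (Rmin_l A' B); lra).
assert (zB : z < B) by (unfold z; generalize (Rmin_r A' B); lra).
destruct (mean_value w dw z B zB) as [c [Hc Ec]]; [intros; apply Dw; lra|].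
assert (wz : w z < w B) by (apply HA', zA).
assert (dwc : 0 < dw c) by nra.
assert (wc : 0 < w c) by (unfold w; specialize (above c ltac:(lra)); lra).
assert (inc : forall x, c <= x <= x1 -> 0 < dw x).
{ intros x Hx.
  destruct (Rlt_le_dec 0 (dw x)) as [|Hn]; [assumption | exfalso].
  destruct (first_zero (fun x => - dw x) c x) as [d [Hd [dwd neg]]]; try lra.
  { intros t Ht; apply continuity_pt_opp.
    apply (derivable_continuity_pt dw t _ (Ddw t ltac:(lra))). }
  assert (wpos : forall t, c <= t <= d -> 0 < w t).
  { intros t Ht; apply Rlt_le_trans with (1 := wc).
    apply (nondecreasing_of_derive w dw); [lra | intros; apply Dw; lra |].
    intros s Hs; destruct (Req_dec s d) as [->|]; [lra|].
    specialize (neg s ltac:(lra)); lra. }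
  assert (dw c <= dw d); [|lra].
  apply (nondecreasing_of_derive dw (fun x => difference_coef y u x * w x));
    [lra | intros; apply Ddw; lra |].
  intros t Ht; specialize (wpos t Ht).
  apply Rmult_le_pos; [|lra].
  assert (yt := hm_gt_sqrt_bound y dy t H ltac:(lra)).
  assert (s0 := sqrt_pos (- t / 6)).
  assert (s2 : sqrt (- t / 6) ^ 2 = - t / 6) by (apply pow2_sqrt; lra).
  unfold difference_coef, w in *; nra. }
assert (w c <= w x1).
{ apply (nondecreasing_of_derive w dw); [lra | intros; apply Dw; lra |].
  intros t Ht; apply Rlt_le, inc, Ht. }
unfold w in *; lra.
Qed.

(** * Restriction to the real line *)

(** Complex differentiability is restricted to real increments, and passing to the real
    part does not increase the modulus of the error. *)
Lemma is_derive_on_line (F : C -> C) (x : R) (l : C) :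
  is_derive F (RtoC x) l -> is_derive (fun t => Re (F (RtoC t))) x (Re l).
Proof.
intros [_ H]; apply is_derive_Reals; intros e He.
assert (He2 : 0 < e / 2) by lra.
destruct (H (RtoC x) (fun P HP => HP) (mkposreal (e / 2) He2)) as [delta Hd].
exists delta; intros h h0 hd.
specialize (Hd (RtoC (x + h))).
assert (E : (RtoC (x + h) - RtoC x)%C = RtoC h) by (rewrite RtoC_plus; ring).
assert (near : Cmod (RtoC (x + h) - RtoC x) < delta) by (rewrite E, Cmod_R; exact hd).
set (D := (F (RtoC (x + h)) - F (RtoC x))%C).
assert (B : Cmod (D - (RtoC (x + h) - RtoC x) * l)%C
            <= e / 2 * Cmod (RtoC (x + h) - RtoC x)%C) by exact (Hd near).
rewrite E, Cmod_R in B.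
assert (Re_D : Re (D - RtoC h * l)%C = Re (F (RtoC (x + h))) - Re (F (RtoC x)) - h * Re l).
{ unfold D; destruct (F (RtoC (x + h))), (F (RtoC x)), l; simpl; ring. }
assert (B' : Rabs (Re (D - RtoC h * l)%C) <= e / 2 * Rabs h).
{ apply Rle_trans with (2 := B), Rle_trans with (2 := Rmax_Cmod _), Rmax_l. }
rewrite Re_D in B'.
assert (hpos : 0 < Rabs h) by (apply Rabs_pos_lt, h0).
apply Rmult_lt_reg_r with (Rabs h); [exact hpos|].
rewrite <- Rabs_mult.
replace (_ * h) with (Re (F (RtoC (x + h))) - Re (F (RtoC x)) - h * Re l) by (field; exact h0).
nra.
Qed.

Lemma on_line_solves (Y : C -> C) (x1 : R) :
  painleve2_meromorphic Y -> real_on_line Y ->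
  (forall x, x <= x1 -> ~ is_pole Y (RtoC x)) ->
  exists du, solves_PII_upto x1 (on_line Y) du.
Proof.
intros [_ [dY HY]] real nopole.
exists (fun t => Re (dY (RtoC t))); intros x Hx.
destruct (HY (RtoC x) (nopole x Hx)) as [D1 D2]; split.
- exact (is_derive_on_line Y x _ D1).
- assert (E : Y (RtoC x) = RtoC (on_line Y x)).
  { rewrite (surjective_pairing (Y (RtoC x))); unfold on_line, RtoC; f_equal.
    exact (real x (nopole x Hx)). }
  replace (_ + _) with (Re (RtoC x * Y (RtoC x) + 2 * Y (RtoC x) ^ 3)%C).
  + exact (is_derive_on_line dY x _ D2).
  + rewrite E; rewrite <- RtoC_pow, <- !RtoC_mult, <- RtoC_plus; reflexivity.
Qed.

Lemma connection_correction_small (b e : R) : 0 < b -> 0 < e ->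
  exists A, forall x, x < A ->
    0 < b / Rpower (- x) (1 / 4) * exp (- (2 * sqrt 2 / 3) * Rpower (- x) (3 / 2)) < e.
Proof.
intros Hb He; pose (T := b / e).
assert (HT : 0 < T) by (apply Rdiv_lt_0_compat; lra).
exists (- T ^ 4); intros x Hx.
assert (T4 : 0 < T ^ 4) by (apply pow_lt, HT).
assert (R1 : T < Rpower (- x) (1 / 4)).
{ replace T with (Rpower (T ^ 4) (1 / 4)) at 1.
  - apply Rlt_Rpower_l; lra.
  - rewrite <- Rpower_pow, Rpower_mult by exact HT.
    replace (INR 4 * (1 / 4)) with 1 by (simpl; field); apply Rpower_1, HT. }
assert (R2 : 0 < Rpower (- x) (3 / 2)) by apply exp_pos.
assert (ex : 0 < exp (- (2 * sqrt 2 / 3) * Rpower (- x) (3 / 2)) < 1).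
{ split; [apply exp_pos|]; rewrite <- exp_0; apply exp_increasing.
  assert (0 < sqrt 2) by (apply sqrt_lt_R0; lra); nra. }
set (z := exp _) in *; clearbody z.
set (p := Rpower (- x) (1 / 4)) in *; clearbody p.
assert (p0 : 0 < p) by lra.
assert (q : 0 < b / p < e).
{ split; [apply Rdiv_lt_0_compat; lra|].
  unfold T in R1; apply Rlt_div_l in R1; [|lra]; apply Rlt_div_l; lra. }
nra.
Qed.

(** For [b > 0] the correction term is positive near [-oo] and decays; for [b = 0] it
    vanishes identically there, and so does the difference of the two solutions. *)
Lemma y_b_ge_y0 (y0 : R -> R) (b : R) (Y : C -> C) (x1 : R) :
  hastings_mcleod y0 -> 0 <= b -> is_y_b y0 b Y -> x1 <= 0 ->
  (forall x, x <= x1 -> ~ is_pole Y (RtoC x)) -> y0 x1 <= on_line Y x1.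
Proof.
intros Hy0 Hb [mer [real as_]] Hx1 nopole.
assert (H := hastings_mcleod_profile y0 Hy0).
destruct (on_line_solves Y x1 mer real nopole) as [du Su].
destruct (asymp_eventually (Rbar_locally m_infty) _ _ 1 ltac:(lra) as_) as [A HA].
destruct Hb as [Hb | <-].
- assert (small : forall e, 0 < e -> exists A', forall x, x < A' -> 0 < on_line Y x - y0 x < e).
  { intros e He.
    destruct (connection_correction_small b (e / 2) Hb ltac:(lra)) as [A1 HA1].
    exists (Rmin A A1); intros x Hx.
    destruct (HA x) as [d [Hd ->]]; [apply Rlt_le_trans with (1 := Hx), Rmin_l|].
    assert (S := HA1 x ltac:(apply Rlt_le_trans with (1 := Hx), Rmin_r)).
    set (g := b / _ * _) in *; split; nra. }
  destruct (small 1 ltac:(lra)) as [A1 HA1].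
  apply Rlt_le, (solution_stays_above y0 (Derive y0) (on_line Y) du x1 A1); auto.
  + intros x Hx; specialize (HA1 x Hx); lra.
  + intros e He; destruct (small e He) as [A' HA']; exists A'; intros x Hx; apply HA', Hx.
- right; symmetry.
  apply (solution_unique_forward y0 (Derive y0) (on_line Y) du x1 A); auto.
  + intros x _; split; [apply (hm_derive _ _ H) | apply (hm_equation _ _ H)].
  + intros x Hx; destruct (HA x Hx) as [d [_ E]].
    replace (0 / Rpower (- x) (1 / 4)) with 0 in E by (unfold Rdiv; ring); lra.
Qed.

Theorem theorem2p4 (y0 : R -> R) (b : R) (Y : C -> C) (sigma : Rbar)
  (Hy0 : hastings_mcleod y0)
  (Hb : 0 <= b)
  (HY : is_y_b y0 b Y)
  (Hsigma : is_first_real_pole Y sigma)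
  (x : R) (Hx : x <= 0) (Hxs : Rbar_lt (Finite x) sigma) :
  on_line Y x >
    Rmax (sqrt (- x / 2) *
          sqrt ((sqrt (1 - 2 * x ^ 3) - 1) / (sqrt (1 - 2 * x ^ 3) + 1)))
         (sqrt (- x / 6)).
Proof.
assert (nopole : forall z, z <= x -> ~ is_pole Y (RtoC z)).
{ intros z Hz pole; destruct sigma as [s | |]; simpl in *.
  - assert (s <= z) by (apply Hsigma, pole); lra.
  - exact (Hsigma z pole).
  - contradiction. }
assert (P := hastings_mcleod_profile y0 Hy0).
apply Rlt_le_trans with (y0 x); [|now apply (y_b_ge_y0 y0 b)].
apply Rmax_lub_lt.
- rewrite algebraic_bound_eq by exact Hx.
  exact (hm_gt_algebraic_bound y0 _ x P Hx).
- exact (hm_gt_sqrt_bound y0 _ x P Hx).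
Qed.
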